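(* For every countable non-amenable group $G$ there exists a finite integer $n$ with the following property: if $G \curvearrowright X$ is any continuous action on a compact metrizable space, then there is a $G$-invariant compact set $Y \subseteq n^G$ such that $G \curvearrowright Y$ continuously factors onto $G \curvearrowright X$. If $G$ contains the rank two free group $\mathrm{F}_2$ as a subgroup, then $n$ can be chosen to be $2$.
   Context: For a positive integer $n$, $n^G$ denotes the set of functions $x : G \to \{1,\dots,n\}$ with the product topology (topology of pointwise convergence) and the left shift action $(g\cdot x)(h) = x(g^{-1}h)$ of $G$. For topological spaces $X, Y$ with $G$-actions, $G \curvearrowright Y$ continuously factors onto $G \curvearrowright X$ if there is a continuous $G$-equivariant surjection $Y \to X$. *)

(* Defs.v *)
From HB Require Import structures.
From mathcomp Require Import all_boot all_order all_algebra all_fingroup.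
From mathcomp Require Import all_classical all_reals all_analysis.

Set Implicit Arguments.
Unset Strict Implicit.
Unset Printing Implicit Defensive.

Import Order.TTheory GRing.Theory Num.Theory.

Local Open Scope classical_set_scope.

(* von Neumann's definition: a left-invariant, finitely additive probability
   measure on all subsets of [G]. *)
Definition amenable (R : realType) (G : groupType) : Prop :=
  exists mu : set G -> R,
    [/\ mu [set: G] = 1%R,
        forall A, (0 <= mu A)%R,
        forall A B, A `&` B = set0 -> mu (A `|` B) = (mu A + mu B)%R
      & forall (g : G) A, mu [set (g * h)%g | h in A] = mu A].

(* The free group on [A], as reduced words. The letter [(a, false)] stands for
   the generator [a] and [(a, true)] for its inverse. *)
Section FreeGroup.
Variable A : choiceType.
Implicit Types (l : A * bool) (w u v : seq (A * bool)).

Definition inv_letter l := (l.1, ~~ l.2).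

Definition reduced w := sorted (fun l l' => l' != inv_letter l) w.

(* Left multiplication of a reduced word by a letter. *)
Definition push l w :=
  if w is l' :: w' then if l' == inv_letter l then w' else l :: w
  else [:: l].

Lemma inv_letterK : involutive inv_letter.
Proof. by case=> a b; rewrite /inv_letter /= negbK. Qed.

Lemma reduced_cons l w : reduced (l :: w) -> reduced w.
Proof. by case: w => //= l' w /andP[]. Qed.

Lemma reduced_push l w : reduced w -> reduced (push l w).
Proof.
case: w => //= l' w rw; case: eqP => [_|/eqP ne]; last by rewrite /= ne.
exact: reduced_cons rw.
Qed.

Lemma push_reduced l w : reduced (l :: w) -> push l w = l :: w.
Proof. by case: w => //= l' w /andP[/negPf ->]. Qed.

Lemma pushK l w : reduced w -> push (inv_letter l) (push l w) = w.
Proof.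
case: w => [|l' w] /=; first by rewrite inv_letterK eqxx.
case: (eqVneq l' (inv_letter l)) => [->|ne] rw.
  exact: push_reduced.
by rewrite /= inv_letterK eqxx.
Qed.

Definition word_mul u v := foldr push v u.
Definition word_inv w := rev (map inv_letter w).

Lemma reduced_word_mul u v : reduced v -> reduced (word_mul u v).
Proof. by move=> rv; elim: u => //= l u; exact: reduced_push. Qed.

Lemma reduced_word_inv w : reduced w -> reduced (word_inv w).
Proof.
rewrite /reduced /word_inv rev_sorted sorted_map.
apply: sub_sorted => l l' /=; apply: contraNneq => e.
by rewrite -(inv_letterK l') -e.
Qed.

Lemma word_mul_push l v w : reduced v -> reduced w ->
  word_mul (push l v) w = push l (word_mul v w).
Proof.
case: v => //= l' v rv rw; case: eqP => //= ->.
have := pushK (inv_letter l) (reduced_word_mul v rw).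
by rewrite inv_letterK => ->.
Qed.

Record free_group := FreeGroup {
  free_word : seq (A * bool);
  _ : reduced free_word }.

HB.instance Definition _ := [isSub for free_word].
HB.instance Definition _ := [Choice of free_group by <:].

Implicit Types x y z : free_group.

Definition free_one : free_group := @FreeGroup [::] isT.
Definition free_mul x y : free_group :=
  FreeGroup (reduced_word_mul (val x) (valP y)).
Definition free_inv x : free_group := FreeGroup (reduced_word_inv (valP x)).

Lemma free_mulA : associative free_mul.
Proof.
move=> x y z; apply: val_inj => /=.
have ry : reduced (free_word y) := valP y.
have rz : reduced (free_word z) := valP z.
elim: (free_word x) => //= l u ->.
by rewrite word_mul_push //; exact: reduced_word_mul.
Qed.

Lemma free_mul1 : left_id free_one free_mul.
Proof. by move=> x; exact: val_inj. Qed.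

Lemma free_mulr1 : right_id free_one free_mul.
Proof.
case=> w rw; apply: val_inj => /=.
elim: w rw => //= l w IH rw.
by rewrite IH ?push_reduced //; exact: reduced_cons rw.
Qed.

Lemma word_mulV w v : reduced v -> word_mul (word_inv w) (word_mul w v) = v.
Proof.
move=> rv; elim: w => //= l w IH.
rewrite /word_inv /= rev_cons -cats1 /word_mul foldr_cat /=.
by rewrite pushK //; exact: reduced_word_mul.
Qed.

Lemma free_mulV : left_inverse free_one free_inv free_mul.
Proof.
move=> x; apply: val_inj => /=.
by have := word_mulV (free_word x) (isT : reduced [::]);
   rewrite [X in word_mul _ X](congr1 val (free_mulr1 x)).
Qed.

Lemma free_mulrV : right_inverse free_one free_inv free_mul.
Proof.
move=> x; have xKK : free_inv (free_inv x) = x.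
  apply: val_inj; rewrite /= /word_inv map_rev revK -map_comp.
  by rewrite (eq_map (_ : _ =1 id)) ?map_id // => l; exact: inv_letterK.
by rewrite -[X in free_mul X]xKK free_mulV.
Qed.

HB.instance Definition _ := isGroup.Build free_group
  free_mulA free_mul1 free_mulr1 free_mulV free_mulrV.

End FreeGroup.

Definition F2 : groupType := free_group bool.

Definition contains_F2 (G : groupType) : Prop :=
  exists f : {multiplicative F2 -> G}, injective f.

Definition continuous_action (G : groupType) (X : topologicalType)
    (act : G -> X -> X) : Prop :=
  [/\ forall x, act 1%g x = x,
      forall g h x, act (g * h)%g x = act g (act h x)
    & forall g, continuous (act g)].

Definition continuously_factors (G : groupType) (Y X : topologicalType)
    (actY : G -> Y -> Y) (actX : G -> X -> X) : Prop :=
  exists phi : Y -> X,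
    [/\ continuous phi,
        forall g y, phi (actY g y) = actX g (phi y)
      & range phi = [set: X]].

Definition metrizable (R : realType) (X : topologicalType) : Prop :=
  exists d : X -> X -> R,
    [/\ forall x y, (0 <= d x y)%R,
        forall x y, d x y = 0%R <-> x = y,
        forall x y, d x y = d y x,
        forall x y z, (d x z <= d x y + d y z)%R
      & forall x (U : set X),
          nbhs x U <-> exists2 e : R, (0 < e)%R & [set y | (d x y < e)%R] `<=` U].

(* [n^G]; the alphabet {1, ..., n} is encoded as ['I_n] = {0, ..., n - 1}. *)
Definition full_shift (G : groupType) (n : nat) : topologicalType :=
  {ptws G -> discrete_topology 'I_n}.

Definition left_shift (G : groupType) (n : nat) (g : G) (x : full_shift G n) :
  full_shift G n := fun h => x (g^-1 * h)%g.

Definition shift_invariant (G : groupType) (n : nat)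
    (Y : set (full_shift G n)) : Prop :=
  forall g x, Y x -> Y (left_shift g x).

(* The shift action restricted to [Y]; the type [set_type Y] carries the
   subspace topology. *)
Definition subshift (G : groupType) (n : nat) (Y : set (full_shift G n))
    (invY : shift_invariant Y) (g : G) (y : set_type Y) : set_type Y :=
  SigSub (mem_set (invY g (val y) (set_mem (valP y)))).

(* Every continuous action of [G] on a compact metrizable space is a continuous
   factor of a compact invariant subset of [n^G]. *)
Definition universal_shift (R : realType) (G : groupType) (n : nat) : Prop :=
  forall (X : topologicalType) (act : G -> X -> X),
    compact [set: X] -> metrizable R X -> continuous_action act ->
    exists (Y : set (full_shift G n)) (invY : shift_invariant Y),
      compact Y /\ continuously_factors (subshift invY) act.

(* Main.v *)
Require Import Defs.
From mathcomp Require Import all_boot all_order all_algebra all_fingroup.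
From mathcomp Require Import finmap.
From mathcomp Require Import all_classical all_reals all_analysis.
From mathcomp Require Import lra zify.

(** Let [X] be a compact metrizable [G]-space. Countably many pairs of closed
    sets, each pair covering [X], separate its points; recording for each pair
    a side on which a point lies describes the point by an infinite string of
    bits, and recording this along the whole orbit describes it by an element
    of [(2^nat)^G]. So it is enough to find, for a suitable [n], a continuous
    equivariant surjection from [n^G] onto [(2^nat)^G]: the points of [n^G]
    whose image describes some point of [X] form a closed invariant set [Y],
    and sending each of them to the point that it describes is a factor map
    ([universal_shift_code]). The entropy of [(2^nat)^G] is infinite, so this
    must use that [G] is not amenable.

    If [G] is not amenable, it has no Folner sets, and products with a large
    finite set [W] at least double the size of every finite set. By Hall's
    marriage theorem there are injections [alpha g = g * a g] and
    [beta g = g * b g] of [G] into itself, with disjoint images and with [a]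
    and [b] valued in [W]. The points [alpha^k (beta g)] are then pairwise
    distinct: each [g] owns infinitely many places of [G], and a configuration
    that displays at each place one bit and the two steps [a], [b] stores an
    arbitrary bit string for every [g]. The reader at [g] follows the steps that
    he sees, so that reading is continuous and equivariant on all
    configurations ([walk_shift_code]).

    If [G] contains a free group on [s], [t], two symbols suffice, by the
    Ornstein-Weiss map. The Cayley graph of the free group is a tree, so the
    increments of [x : G -> Z/2] along the edges [g -- gs] and [g -- gt] can be
    prescribed freely: with [D_s x g = x g + x (gs)] the map
    [x |-> (D_s x, D_t x)] sends [2^G] onto [2^G * 2^G]. Expanding the second
    component again and again, [x |-> (D_s (D_t^k x))_k] reaches every finite
    sequence of configurations, hence by compactness every infinite one
    ([difference_shift_code]). *)

Set Implicit Arguments.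
Unset Strict Implicit.
Unset Printing Implicit Defensive.

Import Order.TTheory GRing.Theory Num.Theory.
Import numFieldNormedType.Exports.

Local Open Scope classical_set_scope.

(** * Limits along exhaustions by finite sets *)

Section Exhaustion.
Variable T : eqType.

(** A property holds near [exhaustion] when it holds for all sufficiently large
    finite subsets of [T], given as lists. It takes the place of a sequence
    exhausting [T]. *)
Definition exhaustion : set_system (seq T) :=
  filter_from setT (fun s : seq T => [set s' : seq T | {subset s <= s'}]).

#[global] Instance exhaustion_filter : ProperFilter exhaustion.
Proof.
apply: filter_from_proper; last by move=> s _; exists s => x.
apply: filter_from_filter; first by exists [::].
move=> s1 s2 _ _; exists (s1 ++ s2) => // s sub.
by split=> x xs; apply: sub; rewrite mem_cat xs ?orbT.
Qed.

Lemma near_exhaustion x : \forall s \near exhaustion, x \in s.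
Proof. by exists [:: x] => // s; apply; rewrite mem_head. Qed.

End Exhaustion.

Section Ultra.
Local Open Scope fset_scope.
Variables (T : Type) (U : set_system T).
Hypothesis ultraU : UltraFilter U.

(** A function taking finitely many values is constant on a set of the
    ultrafilter, as one of its finitely many fibres belongs to it. *)
Lemma ultra_fset (V : choiceType) (h : T -> V) (E : {fset V}) :
  U [set t | h t \in E] -> exists2 v, v \in E & U [set t | h t = v].
Proof.
elim/finSet_rect: E => E IH UE.
have [E0|[v vE]] := fset_0Vmem E.
  by have [t /=] := filter_ex UE; rewrite E0.
have [Uv|Unv] := in_ultra_setVsetC [set t | h t = v] ultraU; first by exists v.
have [|w] := IH (E `\ v) (fproperD1 vE).
  apply: filterS (filterI UE Unv) => t /= [hE /eqP hv].
  by rewrite !inE hv hE.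
by rewrite !inE => /andP[_ wE] Uw; exists w.
Qed.

(** Compactness of the interval gives a cluster point, and a cluster point of an
    ultrafilter is a limit. *)
Lemma ultra_bounded_cvg (R : realType) (h : T -> R) :
  (forall t, (0 <= h t <= 1)%R) -> exists l : R, h @ U --> l.
Proof.
move=> h01.
have UI : U (h @^-1` `[0%R, 1%R]).
  by apply: filterE => t; rewrite /= in_itv /=; exact: h01.
have [l [_ l_lim]] := segment_compact _ (UI : (h @ U) `[0%R, 1%R]).
exists l => V Vl.
have [//|UnV] := in_ultra_setVsetC (h @^-1` V) ultraU.
by have [? []] := l_lim _ _ (UnV : (h @ U) (~` V)) Vl.
Qed.

End Ultra.

(** * Hall's marriage theorem *)

Section Hall.
Local Open Scope fset_scope.
Variables T V : choiceType.
Implicit Types (A : T -> {fset V}) (I J K : {fset T}).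

Definition nbrs A J : {fset V} := \bigcup_(i <- J) A i.

Lemma nbrsP A J v : reflect (exists2 i, i \in J & v \in A i) (v \in nbrs A J).
Proof.
apply: (iffP (bigfcupP _ _ _ _)) => -[i iJ vi]; exists i => //; last by rewrite iJ.
by case/andP: iJ.
Qed.

Definition hall_condition A I := forall J, J `<=` I -> (#|` J| <= #|` nbrs A J|)%N.

Definition strike_out A i x : T -> {fset V} :=
  fun j => if j == i then A i `\ x else A j.

(** Rado's step: as long as [i] has two candidates, one of them can be spared.
    Otherwise striking out [x] is obstructed by a set [J] and striking out [y] by
    a set [K]; by submodularity the neighbours of [J U K U {i}] and of the
    intersection of [J] and [K] are then together one too few. *)
Lemma hall_strike_out A I i x y : hall_condition A I -> i \in I -> x != y ->
  x \in A i -> y \in A i ->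
  hall_condition (strike_out A i x) I \/ hall_condition (strike_out A i y) I.
Proof.
move=> hA iI xy xA yA.
have tight z : ~ hall_condition (strike_out A i z) I -> exists2 J, i |` J `<=` I &
    i \notin J /\ (#|` nbrs A J `|` (A i `\ z)| <= #|` J|)%N.
  move=> /existsNP[J /not_implyP[JI /negP]]; rewrite -ltnNge => lt.
  have iJ : i \in J.
    apply: contraLR lt => niJ; rewrite -leqNgt (leq_trans (hA J JI)) //.
    apply: fsubset_leq_card; apply/fsubsetP => v /nbrsP[j jJ vj].
    apply/nbrsP; exists j => //; rewrite /strike_out; case: eqP => // ji.
    by rewrite ji (negPf niJ) in jJ.
  exists (J `\ i); first by rewrite fsetD1K.
  split; first by rewrite !inE eqxx.
  have := cardfsD1 i J; rewrite iJ add1n => cJ; rewrite cJ ltnS in lt.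
  apply: leq_trans lt; apply: fsubset_leq_card; apply/fsubsetP => v.
  rewrite in_fsetU => /orP[/nbrsP[j]|vi].
    rewrite !inE => /andP[ji jJ] vj; apply/nbrsP; exists j => //.
    by rewrite /strike_out (negPf ji).
  by apply/nbrsP; exists i => //; rewrite /strike_out eqxx.
apply: contrapT => /not_orP[/tight[J JI [iJ cJ]] /tight[K KI [iK cK]]].
set P := _ `|` _ in cJ; set Q := _ `|` _ in cK.
have cU : (#|` J `|` K|.+1 <= #|` P `|` Q|)%N.
  have -> : #|` J `|` K|.+1 = #|` i |` (J `|` K)|.
    by rewrite cardfsU1 inE (negPf iJ) (negPf iK).
  apply: (leq_trans (hA _ _)).
    by rewrite fsetUUr fsubUset JI KI.
  apply: fsubset_leq_card; apply/fsubsetP => v /nbrsP[j].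
  rewrite in_fset1U in_fsetU => /orP[/eqP-> vi|/orP[jJ|jK] vj].
  - rewrite !inE vi !andbT; case: (eqVneq v x) => [->|_]; last by rewrite !orbT.
    by rewrite xy !orbT.
  - by rewrite !in_fsetU; apply/orP; left; apply/orP; left; apply/nbrsP; exists j.
  - by rewrite !in_fsetU; apply/orP; right; apply/orP; left; apply/nbrsP; exists j.
have cI : (#|` J `&` K| <= #|` P `&` Q|)%N.
  apply: (leq_trans (hA _ _)).
    apply: fsubset_trans (fsubsetIl _ _) _.
    by apply: fsubset_trans JI; exact: fsubsetU1.
  apply: fsubset_leq_card; apply/fsubsetP => v /nbrsP[j].
  rewrite !inE => /andP[jJ jK] vj.
  have -> : v \in nbrs A J by apply/nbrsP; exists j.
  by have -> : v \in nbrs A K by apply/nbrsP; exists j.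
have := cardfsUI J K; have := cardfsUI P Q; lia.
Qed.

(** Striking out candidates ends with one candidate for each index; the marriage
    condition on pairs says that these are distinct. The element [v0] only
    serves as a value off [I]. *)
Lemma finite_hall (v0 : V) A I : hall_condition A I ->
  exists m : T -> V, (forall i, i \in I -> m i \in A i) /\ {in I &, injective m}.
Proof.
have [N] := ubnP (\sum_(i <- I) #|` A i|).
elim: N A => // N IH A lt hA.
have [[i [x [y [iI xA yA xy]]]]|no_choice] := pselect (exists i x y,
    [/\ i \in I, x \in A i, y \in A i & x != y]).
  have step z : z \in A i -> hall_condition (strike_out A i z) I ->
      exists m : T -> V, (forall i, i \in I -> m i \in A i) /\ {in I &, injective m}.
    move=> zA /IH[|m [mA m_inj]].
      rewrite ltnS in lt; apply: leq_trans lt.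
      rewrite !(big_fsetD1 i iI) /= /strike_out eqxx.
      rewrite (cardfsD1 z (A i)) zA add1n addSn ltnS leq_add2l.
      rewrite big_seq [leqRHS]big_seq; apply: leq_sum => j.
      by rewrite !inE => /andP[/negPf-> _].
    exists m; split=> // j jI; have := mA j jI; rewrite /strike_out.
    by case: eqP => // ->; rewrite !inE => /andP[].
  by case: (hall_strike_out hA iI xy xA yA); exact: step.
have uniq_choice i x y : i \in I -> x \in A i -> y \in A i -> x = y.
  move=> iI xA yA; apply/eqP/negPn/negP => xy.
  by apply: no_choice; exists i, x, y.
have has_choice i : exists v, i \in I -> v \in A i.
  have [iI|] := boolP (i \in I); last by exists v0.
  have := hA [fset i]; rewrite fsub1set cardfs1 => /(_ iI) pos.
  have /fset0Pn[v] : nbrs A [fset i] != fset0 by rewrite -cardfs_gt0.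
  by case/nbrsP => j; rewrite inE => /eqP-> vi; exists v.
have [m mA] := choice has_choice.
exists m; split => // i j iI jI mij; apply/eqP/negPn/negP => ij.
have := hA [fset i; j]; rewrite fsubUset !fsub1set iI jI cardfs2 ij => /(_ isT).
apply/negP; rewrite -ltnNge ltnS /= -(cardfs1 (m i)).
apply: fsubset_leq_card; apply/fsubsetP => v /nbrsP[k].
rewrite !inE => /orP[]/eqP-> vk; apply/eqP.
  exact: uniq_choice vk (mA _ iI).
by rewrite mij; apply: uniq_choice vk (mA _ jI).
Qed.

(** The candidates of one index are finitely many, so matchings of the finite
    subsets of [T] converge pointwise along an ultrafilter. *)
Lemma hall (v0 : V) A :
  (forall J : {fset T}, (#|` J| <= #|` nbrs A J|)%N) ->
  exists m : T -> V, (forall i, m i \in A i) /\ injective m.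
Proof.
move=> hA.
have [U [ultraU UE]] := ultraFilterLemma (exhaustion_filter T).
have fin (s : seq T) : exists m : T -> V,
    (forall i, i \in s -> m i \in A i) /\ {in s &, injective m}.
  have [|m [mA m_inj]] := @finite_hall v0 A [fset i in s]; first by move=> J _.
  exists m; split; first by move=> i iS; apply: mA; rewrite inE.
  by move=> i j iS jS; apply: m_inj; rewrite inE.
have [m mP] := choice fin.
have near_mem i : U [set s | i \in s] by exact: (UE _ (near_exhaustion i)).
(* At each index the finite matchings agree with one value almost always. *)
have lim i : exists v, v \in A i /\ U [set s | m s i = v].
  have [|v vA Uv] := @ultra_fset _ _ ultraU V (m^~ i) (A i); last by exists v.
  by apply: filterS (near_mem i) => s /=; have [+ _] := mP s; apply.
have [M MP] := choice lim.
exists M; split=> [i|i j Mij]; first by have [] := MP i.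
have [_ Ui] := MP i; have [_ Uj] := MP j.
have [s /= [[mi mj] [iS jS]]] :=
  filter_ex (filterI (filterI Ui Uj) (filterI (near_mem i) (near_mem j))).
by have [_] := mP s; apply => //; rewrite mi mj.
Qed.

End Hall.

(** * Non-amenability and paradoxical decompositions *)

Section Expansion.
Local Open Scope fset_scope.
Variable G : groupType.
Implicit Types (F K W : {fset G}) (g : G) (P : set G).

Definition mulfs F K : {fset G} := [fset (x * k)%g | x in F, k in K].

Lemma mem_mulfs F K x k : x \in F -> k \in K -> (x * k)%g \in mulfs F K.
Proof. by move=> xF kK; apply/imfset2P; exists x => //; exists k. Qed.

(** [F] below is almost invariant under multiplication on the right, whereas an
    invariant mean has to be invariant on the left: this is why frequencies
    are taken along the inverses of the elements of [F]. *)
Definition inverse_hits F P : {fset G} := [fset x in F | `[< P (x^-1)%g >]].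

Definition frequency (R : realType) F P : R :=
  (#|` inverse_hits F P|%:R / #|` F|%:R)%R.

Lemma inverse_hitsP F P x :
  reflect (x \in F /\ P (x^-1)%g) (x \in inverse_hits F P).
Proof. by rewrite !inE; apply: (iffP andP) => -[xF /asboolP]. Qed.

Lemma frequency01 R F P : (0 <= frequency R F P <= 1)%R.
Proof.
have [->|F0] := eqVneq F fset0.
  by rewrite /frequency cardfs0 invr0 mulr0 lexx ler01.
rewrite divr_ge0 //= ler_pdivrMr ?ltr0n ?cardfs_gt0 // mul1r ler_nat.
by apply: fsubset_leq_card; apply/fsubsetP => x /inverse_hitsP[].
Qed.

Lemma frequencyT R F : F != fset0 -> frequency R F setT = 1%R.
Proof.
move=> F0; rewrite /frequency (_ : inverse_hits F setT = F).
  by rewrite divff // pnatr_eq0 cardfs_eq0.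
by apply/fsetP => x; apply/inverse_hitsP/idP => [[]|].
Qed.

Lemma frequencyU R F P Q : (P `&` Q)%classic = set0 ->
  frequency R F (P `|` Q)%classic = (frequency R F P + frequency R F Q)%R.
Proof.
move=> PQ; rewrite /frequency -mulrDl -natrD.
have -> : inverse_hits F (P `|` Q)%classic = inverse_hits F P `|` inverse_hits F Q.
  apply/fsetP => x; rewrite in_fsetU; apply/inverse_hitsP/orP.
    by case=> xF [] ?; [left|right]; apply/inverse_hitsP.
  by case=> /inverse_hitsP[xF ?]; split=> //; [left|right].
rewrite -cardfsUI (_ : inverse_hits F P `&` inverse_hits F Q = fset0);
  first by rewrite cardfs0 addn0.
apply/fsetP => x; rewrite in_fsetI; apply/negbTE/negP.
case/andP => /inverse_hitsP[_ xP] /inverse_hitsP[_ xQ].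
by have : (P `&` Q)%classic (x^-1)%g by []; rewrite PQ.
Qed.

(** Right multiplication by [g] carries the hits of [gP] in [F] to hits of [P] in
    [FK], all of which lie in [F] up to the few elements of [FK \ F]. *)
Lemma frequency_translate R F K n g P :
  F != fset0 -> 1%g \in K -> g \in K ->
  (n.+1 * #|` mulfs F K| <= n.+2 * #|` F|)%N ->
  (frequency R F [set g * h | h in P]%g <= frequency R F P + n.+1%:R^-1)%R.
Proof.
move=> F0 K1 gK FK.
have FsubFK : F `<=` mulfs F K.
  by apply/fsubsetP => x xF; rewrite -(mulg1 x); exact: mem_mulfs.
have cardD : (#|` mulfs F K| = #|` F| + #|` mulfs F K `\` F|)%N.
  by rewrite cardfsD (fsetIidPr FsubFK) subnKC // fsubset_leq_card.
have hits : (#|` inverse_hits F [set g * h | h in P]%g| <=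
             #|` inverse_hits F P| + #|` mulfs F K `\` F|)%N.
  set S := inverse_hits _ _.
  have <- : #|` [fset (x * g)%g | x in S]| = #|` S|.
    by apply: card_imfset; exact: mulIg.
  apply: leq_trans (_ : #|` inverse_hits F P `|` (mulfs F K `\` F)| <= _)%N.
    apply: fsubset_leq_card; apply/fsubsetP => y.
    case/imfsetP => x /inverse_hitsP[xF [h Ph hx]] ->.
    rewrite in_fsetU in_fsetD mem_mulfs // andbT.
    have [xgF|//] := boolP (x * g \in F)%g; last by rewrite orbT.
    apply/orP; left; apply/inverse_hitsP; split => //.
    by rewrite invgM -hx mulKg.
  by rewrite cardfsU leq_subr.
have cF : (0 < #|` F|%:R :> R)%R by rewrite ltr0n cardfs_gt0.
rewrite /frequency ler_pdivrMr // mulrDl divfK ?gt_eqF //.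
rewrite -(ler_pM2l (ltr0Sn R n)) mulrDr mulrA divff ?pnatr_eq0 // mul1r.
rewrite -!natrM -natrD ler_nat; nia.
Qed.

(** The mean is the limit of the frequencies in Folner sets that are more and more
    invariant. The index [s] is a finite set of requests [(g, n)]: invariance
    under [g] up to [1 / (n + 1)]. *)
Lemma amenable_of_folner (R : realType) :
  (forall K n, exists2 F, F != fset0 &
     (n.+1 * #|` mulfs F K| <= n.+2 * #|` F|)%N) ->
  amenable R G.
Proof.
move=> folner.
pose K (s : seq (G * nat)) := 1%g |` [fset p.1 | p in s].
pose N (s : seq (G * nat)) := (\max_(p <- s) p.2)%N.
have folner_at s : exists F, F != fset0 /\
    ((N s).+1 * #|` mulfs F (K s)| <= (N s).+2 * #|` F|)%N.
  by have [F] := folner (K s) (N s); exists F.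
have [F FP] := choice folner_at.
have F0 s : F s != fset0 by have [] := FP s.
have FK s := proj2 (FP s).
have [U [ultraU UE]] := ultraFilterLemma (exhaustion_filter (G * nat)%type).
have PU : ProperFilter U by exact: ultra_proper.
have [mu mu_lim] := choice (fun P =>
  ultra_bounded_cvg ultraU (fun s => frequency01 R (F s) P)).
have near_le (P Q : set G) (e : R) :
    U [set s | (frequency R (F s) P <= frequency R (F s) Q + e)%R] ->
    (mu P <= mu Q + e)%R.
  move=> le.
  rewrite -subr_ge0 addrAC.
  have gap_lim : (fun s => frequency R (F s) Q - frequency R (F s) P + e)%R @ U -->
      (mu Q - mu P + e)%R.
    by apply: cvgD; [exact: cvgB|exact: cvg_cst].
  apply: (closed_cvg (fun r : R => (0 <= r)%R) (@closed_ge R 0%R) _ _ gap_lim).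
  by apply: filterS le => s /=; rewrite -subr_ge0 addrAC.
(* Invariance up to any [e] follows from the requests [(g, n)] with small
   [1 / (n + 1)]; the reverse inequality comes from [g^-1]. *)
have mu_translate g P : (mu [set g * h | h in P]%g <= mu P)%R.
  apply/ler_addgt0Pr => e e0.
  have [n _ /(_ n (leqnn n)) /= ne] := near_infty_natSinv_lt (PosNum e0).
  apply: near_le; apply: (@filterS _ U) (UE _ (near_exhaustion (g, n))) => s /= gs.
  have K1 : 1%g \in K s by rewrite !inE eqxx.
  have Kg : g \in K s.
    by rewrite in_fset1U; apply/orP; right; apply/imfsetP; exists (g, n).
  apply: (le_trans (frequency_translate R P (F0 s) K1 Kg (FK s))).
  rewrite lerD2l (le_trans _ (ltW ne)) // lef_pV2 ?posrE ?ltr0n // ler_nat ltnS.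
  exact: (@leq_bigmax_seq _ s xpredT (fun p : G * nat => p.2) (g, n)).
exists mu; split.
- have lim1 := mu_lim setT.
  have E : (fun s => frequency R (F s) setT) = fun=> 1%R.
    by apply/funext => s; exact: frequencyT.
  have lim1' : (fun _ : seq (G * nat) => 1%R : R) @ U --> (1%R : R).
    exact: cvg_cst.
  by rewrite E in lim1; exact: (cvg_unique _ lim1 lim1').
- move=> P.
  apply: (closed_cvg (fun r : R => (0 <= r)%R) (@closed_ge R 0%R) _ _ (mu_lim P)).
  by apply: filterE => s; case/andP: (frequency01 R (F s) P).
- move=> P Q PQ; have limU := mu_lim (P `|` Q)%classic.
  have E : (fun s => frequency R (F s) (P `|` Q)%classic) =
      fun s => (frequency R (F s) P + frequency R (F s) Q)%R.
    by apply/funext => s; exact: frequencyU.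
  have limD := cvgD (mu_lim P) (mu_lim Q).
  by rewrite E in limU; exact: (cvg_unique _ limU (limD _)).
move=> g P; apply/eqP; rewrite eq_le mu_translate /=.
have := mu_translate (g^-1)%g [set g * h | h in P]%g.
suff -> : [set g^-1 * h | h in [set g * h | h in P]]%g = P by [].
apply/seteqP; split=> [h [_ [k Pk <-] <-]|h Ph]; first by rewrite mulKg.
by exists (g * h)%g; [exists h|rewrite mulKg].
Qed.

(** Without Folner sets for [K], every [F] grows by the factor [(n + 2) / (n + 1)]
    when multiplied by [K]; by Bernoulli's inequality [n + 1] multiplications at
    least double it. *)
Lemma doubling_of_nonamenable (R : realType) : ~ amenable R G ->
  exists W, forall F, (2 * #|` F| <= #|` mulfs F W|)%N.
Proof.
move=> /(contra_not (@amenable_of_folner R)) /existsNP[K /existsNP[n nF]].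
have grow F : (n.+2 * #|` F| <= n.+1 * #|` mulfs F K|)%N.
  have [->|F0] := eqVneq F fset0; first by rewrite cardfs0 muln0.
  by rewrite leqNgt; apply/negP => /ltnW lt; apply: nF; exists F.
have mulfsA F K1 K2 : mulfs (mulfs F K1) K2 = mulfs F (mulfs K1 K2).
  apply/fsetP => x; apply/imfset2P/imfset2P.
    move=> [y /imfset2P[z zF [k kK ->]] [l lK ->]].
    by exists z => //; exists (k * l)%g; rewrite ?mem_mulfs ?mulgA.
  move=> [z zF [y /imfset2P[k kK [l lK ->]] ->]].
  by exists (z * k)%g; rewrite ?mem_mulfs //; exists l; rewrite ?mulgA.
pose Kpow j := iter j (fun W => mulfs W K) [fset 1%g].
have mulfs1 F : mulfs F [fset 1%g] = F.
  apply/fsetP => x; apply/imfset2P/idP => [[y yF [k]]|xF].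
    by rewrite inE => /eqP-> ->; rewrite mulg1.
  by exists x => //; exists 1%g; rewrite ?inE ?mulg1.
have growj F j : (n.+2 ^ j * #|` F| <= n.+1 ^ j * #|` mulfs F (Kpow j)|)%N.
  elim: j => [|j IH] /=; first by rewrite mulfs1.
  rewrite -mulfsA !expnS -mulnA.
  apply: leq_trans (leq_mul (leqnn _) IH) _.
  by rewrite mulnCA (mulnC n.+1) -[leqRHS]mulnA leq_pmul2l ?expn_gt0.
have bernoulli : (2 * n.+1 ^ n.+1 <= n.+2 ^ n.+1)%N.
  have bern j : (n.+1 ^ j * (n.+1 + j) <= n.+1 * n.+2 ^ j)%N.
    elim: j => [|j IH]; first by rewrite !expn0; lia.
    have step : (n.+1 ^ j * n.+1 <= n.+1 ^ j * (n.+1 + j))%N.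
      by rewrite leq_mul2l leq_addr orbT.
    have := leq_mul (leqnn n.+2) IH; rewrite !expnS; lia.
  have := bern n.+1; rewrite addnn -mul2n mulnCA mulnA mulnC leq_pmul2l //.
exists (Kpow n.+1) => F.
rewrite -(@leq_pmul2l (n.+1 ^ n.+1)) ?expn_gt0 //.
apply: (leq_trans _ (growj F n.+1)); rewrite mulnCA mulnA leq_mul2r bernoulli orbT //.
Qed.

(** Hall's theorem for the index set [G * bool], in which every [g] occurs twice
    with [gW] as candidates: a set of [m] indices involves at least [m / 2]
    elements of [G], whose candidates number at least [m]. *)
Lemma paradoxical_of_doubling W :
  (forall F, 2 * #|` F| <= #|` mulfs F W|)%N ->
  exists a b : G -> G, [/\ forall g, a g \in W /\ b g \in W,
    injective (fun g => g * a g)%g, injective (fun g => g * b g)%g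
    & forall g h, (g * a g <> h * b h)%g].
Proof.
move=> dbl.
pose A (i : G * bool) := mulfs [fset i.1] W.
have [|m [mA m_inj]] := @hall _ _ (1%g : G) A.
  move=> J; pose F := [fset i.1 | i in J].
  have JF : (#|` J| <= 2 * #|` F|)%N.
    pose copy (b : bool) := [fset (x, b) | x in F].
    have copyF b : (#|` copy b| <= #|` F|)%N by exact: leq_imfset_card.
    have JU : J `<=` copy true `|` copy false.
      apply/fsubsetP => -[x b] xbJ; rewrite in_fsetU.
      have xF : x \in F by apply/imfsetP; exists (x, b).
      by case: b {xbJ}; apply/orP; [left|right]; apply/imfsetP; exists x.
    apply: (leq_trans (fsubset_leq_card JU)); rewrite cardfsU mul2n -addnn.
    by apply: (leq_trans (leq_subr _ _)); exact: leq_add.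
  apply: (leq_trans JF); apply: (leq_trans (dbl F)).
  apply: fsubset_leq_card; apply/fsubsetP => v.
  case/imfset2P => x /imfsetP[i iJ ->] [k kW ->].
  by apply/nbrsP; exists i => //; apply: mem_mulfs; rewrite ?inE.
have mE i : (i.1^-1 * m i)%g \in W.
  have /imfset2P[x + [k kW ->]] := mA i.
  by rewrite inE => /eqP ->; rewrite mulKg.
exists (fun g => g^-1 * m (g, true))%g, (fun g => g^-1 * m (g, false))%g.
split.
- by move=> g; split; exact: (mE (g, _)).
- by move=> g h; rewrite !mulVKg => /m_inj[].
- by move=> g h; rewrite !mulVKg => /m_inj[].
- by move=> g h; rewrite !mulVKg => /m_inj[].
Qed.

End Expansion.

(** * Coding actions on compact metrizable spaces by bits *)

Section FullShift.
Variables (G : groupType) (n : nat).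
Implicit Types y : full_shift G n.

Lemma full_shift_compact (A : set (full_shift G n)) : closed A -> compact A.
Proof.
move=> clA; rewrite -(setTI A); apply: compact_closedI => //.
have cI : compact [set: discrete_topology 'I_n].
  by apply: finite_compact; exact: (@finite_finset 'I_n).
have := @tychonoff G (fun=> discrete_topology 'I_n) (fun=> setT) (fun=> cI).
by congr compact; apply/seteqP; split.
Qed.

Lemma near_coordinate y g : \forall y' \near y, y' g = y g.
Proof.
have h : nbhs (y g : discrete_topology 'I_n) [set z | z = y g].
  apply: open_nbhs_nbhs; split=> //; exact: discrete_open.
exact: (@proj_continuous G (fun=> discrete_topology 'I_n) g y _ h).
Qed.

End FullShift.

(** The pairs are [d c x <= r] and [d c x >= r], where [c] runs through a finite
    [r]-net and [r] through a sequence of radii tending to zero. If [r] is less than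
    half the distance of [x] and [y], a point [c] of the net near [x] separates
    them. *)
Lemma compact_metrizable_separating (R : realType) (X : topologicalType) :
  compact [set: X] -> metrizable R X ->
  exists A B : nat -> set X,
    [/\ forall j, closed (A j), forall j, closed (B j),
        forall j x, A j x \/ B j x
      & forall x y, x <> y -> exists j, ~ B j x /\ ~ A j y].
Proof.
move=> cX [d [d_ge0 d_eq0 dC d_tri nbhs_d]].
have near_ball x e : (0 < e)%R -> \forall y \near x, (d x y < e)%R.
  by move=> e0; apply/nbhs_d; exists e.
have closed_le c e : closed [set x | (d c x <= e)%R].
  rewrite -openC openE => x /= /negP; rewrite -ltNge => ex.
  rewrite /interior; near=> y => /=; apply/negP; rewrite -ltNge.
  have dxy : (d x y < d c x - e)%R.
    by near: y; apply: near_ball; rewrite subr_gt0.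
  by have := d_tri c y x; rewrite (dC y x); lra.
have closed_ge c e : closed [set x | (e <= d c x)%R].
  rewrite -openC openE => x /= /negP; rewrite -ltNge => ex.
  rewrite /interior; near=> y => /=; apply/negP; rewrite -ltNge.
  have dxy : (d x y < e - d c x)%R.
    by near: y; apply: near_ball; rewrite subr_gt0.
  by have := d_tri c x y; lra.
pose r (k : nat) : R := (k.+1%:R^-1)%R.
have r_gt0 k : (0 < r k)%R by rewrite invr_gt0 ltr0n.
have net k : exists s : seq X, forall x, exists2 c, c \in s & (d c x < r k)%R.
  have /compact_near_coveringP cov := cX.
  have H : \forall s \near exhaustion (T:=X),
      [set: X] `<=` (fun x => exists2 c, c \in s & (d c x < r k)%R).
    apply: cov => x _.
    near=> y s; exists x => /=.
      by near: s; exact: near_exhaustion.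
    by near: y; exact: near_ball.
  by have [s sP] := filter_ex H; exists s => x; exact: (sP x).
have [s s_net] := choice net.
(* The pair number [j] comes from the centre number [i] of the net number [k],
   where [j] encodes [(k, i)]; the numbers encoding no centre give the pair of
   [X] with itself. *)
pose pair_with (P : X -> nat -> set X) j :=
  if (choice.unpickle j : option (nat * nat)) is Some (k, i) then
    if onth (s k) i is Some c then P c k else setT
  else setT.
exists (pair_with (fun c k => [set x | (d c x <= r k)%R])).
exists (pair_with (fun c k => [set x | (r k <= d c x)%R])).
split.
- move=> j; rewrite /pair_with;
  case: (choice.unpickle j : option (nat * nat)) => [[k i]|]; last exact: closedT.
  by case: onth => [c|]; [exact: closed_le|exact: closedT].
- move=> j; rewrite /pair_with;
  case: (choice.unpickle j : option (nat * nat)) => [[k i]|]; last exact: closedT.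
  by case: onth => [c|]; [exact: closed_ge|exact: closedT].
- move=> j x; rewrite /pair_with;
  case: (choice.unpickle j : option (nat * nat)) => [[k i]|]; last by left.
  case: onth => [c|]; last by left.
  by have [|/ltW] := leP (d c x) (r k); [left|right].
move=> x y xy.
have dxy : (0 < d x y)%R.
  by rewrite lt_neqAle d_ge0 andbT eq_sym; apply/eqP => /d_eq0.
have [k rk] : exists k, (r k + r k < d x y)%R.
  have d2 := divr_gt0 dxy (ltr0Sn R 1).
  have [k _ /(_ k (leqnn k)) /= h] := near_infty_natSinv_lt (PosNum d2); exists k.
  have {}h : (r k < d x y / 2)%R := h.
  by lra.
have [c /onthP[i ci] cx] := s_net k x.
exists (choice.pickle (k, i)); rewrite /pair_with choice.pickleK ci; split; apply/negP.
  by rewrite -ltNge.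
by rewrite -ltNge; have := d_tri x c y; rewrite (dC x c); lra.
Unshelve. all: by end_near. Qed.

Section Codes.
Variables (G : groupType) (n : nat).

(** A continuous equivariant surjection from [n^G] onto [(2^nat)^G]; continuity is
    local constancy of each bit. *)
Definition shift_code (dec : full_shift G n -> G -> nat -> bool) : Prop :=
  [/\ forall y g k, \forall y' \near y, dec y' g k = dec y g k,
      forall h y g k, dec (left_shift h y) g k = dec y (h^-1 * g)%g k
    & forall z, exists y, forall g k, dec y g k = z g k].

(** A configuration [y] is related to [x] when for all [g] and [j] the bit [(g, j)]
    that it encodes names a member of the pair number [j] in which [g^-1 x] lies.
    At most one [x] is related to a given [y], since the pairs separate points, and
    every [x] is related to some [y], since the pairs cover [X]. The relation is
    closed, and projections along the compact space [X] preserve closedness: this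
    gives at once that [Y] is closed and that the factor map is continuous. *)
Lemma universal_shift_code (R : realType) dec :
  shift_code dec -> universal_shift R G n.
Proof.
case=> dec_near dec_shift dec_onto X act cX mX [act1 actM act_cont].
have [A [B [clA clB AB sep]]] := compact_metrizable_separating cX mX.
pose C (b : bool) j := if b then A j else B j.
have clC b j : closed (C b j) by case: b.
pose rel y x := forall g j, C (dec y g j) j (act g^-1%g x).
(* Around each [x], leaving [D] or one wrong bit refutes the relation to all
   configurations near [y]; by compactness of [X] one neighbourhood of [y] works
   for all [x]. *)
have proj_closed (D : set X) : closed D -> closed [set y | exists2 x, D x & rel y x].
  move=> clD; rewrite -openC openE => y /= no_x; rewrite /interior.
  have /compact_near_coveringP cov := cX.
  have H : \forall y' \near y, [set: X] `<=` (fun x => ~ (D x /\ rel y' x)).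
    apply: (cov _ (nbhs y) (fun y' x => ~ (D x /\ rel y' x))) => x _.
    have [Dx|nDx] := pselect (D x); last first.
      have nx : \forall x' \near x, ~ D x'.
        by apply: open_nbhs_nbhs; split => //; exact: closed_openC.
      near=> x' y' => /= -[Dx' _].
      by apply: (near nx x').
    have : ~ rel y x by move=> yx; apply: no_x; exists x.
    move=> /existsNP[g /existsNP[j nC]].
    have nx : \forall x' \near x, ~ C (dec y g j) j (act g^-1%g x').
      have h : nbhs (act g^-1%g x) (~` C (dec y g j) j).
        by apply: open_nbhs_nbhs; split => //; exact: closed_openC.
      exact: (act_cont g^-1%g x _ h).
    near=> x' y' => /= -[_ yx'].
    apply: (near nx x') => //.
    by rewrite -(near (dec_near y g j) y').
  by apply: filterS H => y' H' [x Dx yx]; apply: (H' x).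
have rel_inj y x x' : rel y x -> rel y x' -> x = x'.
  move=> yx yx'; apply: contrapT => /sep[j [nB nA]].
  have := yx 1%g j; have := yx' 1%g j; rewrite invg1 !act1.
  by case: (dec y 1%g j).
have rel_shift h y x : rel y x -> rel (left_shift h y) (act h x).
  move=> yx g j; rewrite dec_shift -actM.
  by have := yx (h^-1 * g)%g j; rewrite invgM invgK.
pose Y : set (full_shift G n) := [set y | exists x, rel y x].
have invY : shift_invariant Y.
  by move=> h y [x yx]; exists (act h x); exact: rel_shift.
have clY : closed Y.
  have := proj_closed setT closedT; congr closed.
  by apply/seteqP; split => y [x]; exists x.
exists Y, invY; split; first exact: full_shift_compact.
have phiP (y : set_type Y) : exists x, rel (val y) x by exact: (set_mem (valP y)).
have [phi phi_rel] := choice phiP.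
exists phi; split.
- apply/continuous_closedP => D clD.
  have -> : phi @^-1` D = val @^-1` [set y | exists2 x, D x & rel y x].
    apply/seteqP; split => y /=; first by exists (phi y); last exact: phi_rel.
    by case=> x Dx yx; rewrite (rel_inj _ _ _ (phi_rel y) yx).
  have /continuous_closedP := @initial_continuous (set_type Y) _ val.
  by apply; exact: proj_closed.
- by move=> g y; apply: (rel_inj _ _ _ (phi_rel _)); exact: rel_shift.
- apply/seteqP; split => // x _.
  have [y yE] := dec_onto (fun g j => `[< A j (act g^-1%g x) >]).
  have yx : rel y x.
    move=> g j; rewrite /C yE; case: asboolP => // nA.
    by have [] := AB j (act g^-1%g x).
  have Yy : Y y by exists x.
  exists (SigSub (mem_set Yy)) => //=.
  exact: (rel_inj _ _ _ (phi_rel _)).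
Unshelve. all: by end_near. Qed.

End Codes.

(** * A code on the full shift of a non-amenable group *)

(** Cancelling [p] from both sides, the two sides run out together: an image of
    [q] is never an image of [p]. *)
Lemma iter_inj_disjoint (T : Type) (p q : T -> T) : injective p -> injective q ->
  (forall x x', p x <> q x') ->
  forall k k' x x', iter k p (q x) = iter k' p (q x') -> k = k' /\ x = x'.
Proof.
move=> p_inj q_inj pq; elim=> [|k IH] [|k'] x x' /=.
- by move=> /q_inj.
- by move=> /esym/pq.
- by move=> /pq.
- by move=> /p_inj /IH[-> ->].
Qed.

Section WalkCode.
Variables (G : groupType) (W : {fset G}).

(** A symbol consists of a step for continuing a walk, a step for starting one, and
    a bit. *)
Definition walk_alphabet : finType := (W * W * bool)%type.

Definition symbol_at (y : full_shift G #|walk_alphabet|) g : walk_alphabet :=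
  enum_val (y g).

Definition walk_step y g : G := (g * val (symbol_at y g).1.1)%g.
Definition walk_start y g : G := (g * val (symbol_at y g).1.2)%g.

(** The place where bit [k] of the string of [g] is stored. It depends on [y], but
    only through finitely many symbols, and it moves along with [y] under
    translation. *)
Definition walk y g k : G := iter k (walk_step y) (walk_start y g).

Definition walk_code y g k : bool := (symbol_at y (walk y g k)).2.

Lemma symbol_near y g : \forall y' \near y, symbol_at y' g = symbol_at y g.
Proof. by apply: filterS (near_coordinate y g) => y'; rewrite /symbol_at => ->. Qed.

Lemma walk_near y g k : \forall y' \near y, walk y' g k = walk y g k.
Proof.
elim: k => [|k IH].
  by apply: filterS (symbol_near y g) => y'; rewrite /walk /= /walk_start => ->.
apply: filterS (filterI IH (symbol_near y (walk y g k))) => y' [].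
by rewrite /walk /= {2}/walk_step => -> E; rewrite /walk_step E.
Qed.

Lemma walk_shift h y g k :
  walk (left_shift h y) g k = (h * walk y (h^-1 * g) k)%g.
Proof.
elim: k => [|k]; first by rewrite /walk /= /walk_start !mulgA mulgV mul1g.
rewrite /walk /= => ->; rewrite /walk_step -mulgA; congr (_ * (_ * val _.1.1))%g.
by rewrite /symbol_at /left_shift mulKg.
Qed.

(** The configuration displaying [a] and [b] gives distinct places to distinct pairs
    [(g, k)], so that its bits can be chosen to encode any given [z]. *)
Lemma walk_shift_code (a b : G -> G) :
  (forall g, a g \in W /\ b g \in W) ->
  injective (fun g => g * a g)%g -> injective (fun g => g * b g)%g ->
  (forall g h, g * a g <> h * b h)%g ->
  shift_code walk_code.
Proof.
move=> abW a_inj b_inj ab; split.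
- move=> y g k.
  apply: filterS (filterI (walk_near y g k) (symbol_near y (walk y g k))) => y' [].
  by rewrite /walk_code => -> ->.
- by move=> h y g k; rewrite /walk_code walk_shift /symbol_at /left_shift mulKg.
move=> z.
pose pos g k := iter k (fun g => g * a g)%g (g * b g)%g.
(* The bit at a place is the bit to be stored by the unique pair owning it,
   and false at places without owner. *)
pose B h := `[< exists g k, h = pos g k /\ z g k >].
pose y : full_shift G #|walk_alphabet| := fun g => enum_rank
  ([` proj1 (abW g)]%fset, [` proj2 (abW g)]%fset, B g).
have yE g : symbol_at y g = ([` proj1 (abW g)]%fset, [` proj2 (abW g)]%fset, B g).
  exact: enum_rankK.
have walkE g k : walk y g k = pos g k.
  elim: k => [|k IH]; first by rewrite /walk /= /walk_start yE.
  by rewrite /walk /= -/(walk y g k) IH /walk_step yE.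
exists y => g k; rewrite /walk_code walkE yE /= /B.
apply/asboolP/idP => [[g' [k' [posE zg'k']]]|zgk]; last by exists g, k.
by have [-> ->] := iter_inj_disjoint a_inj b_inj ab posE.
Qed.

End WalkCode.

(** * A code with two symbols over a free subgroup *)

Section LimitCodes.
Variables (G : groupType) (n : nat) (dec : full_shift G n -> G -> nat -> bool).
Hypothesis dec_near : forall y g k, \forall y' \near y, dec y' g k = dec y g k.

(** A cluster point of configurations encoding [z] up to [N] encodes all of [z]: each
    bit is constant near it. *)
Lemma onto_of_prefixes (z : G -> nat -> bool) :
  (forall N, exists y, forall g k, (k < N)%N -> dec y g k = z g k) ->
  exists y, forall g k, dec y g k = z g k.
Proof.
move=> /choice[Y Y_z].
have YT : (Y @ \oo) [set: full_shift G n] by exact: filterT.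
have [y [_ y_lim]] := full_shift_compact (@closedT (full_shift G n)) _ YT.
exists y => g k.
have Fz : (Y @ \oo) [set y' | dec y' g k = z g k].
  by exists k.+1 => // N /= kN; exact: Y_z.
by have [y' [/= <- ->]] := y_lim _ _ Fz (dec_near y g k).
Qed.

End LimitCodes.

Section FreeIncrements.
Variables (G : groupType) (f : {multiplicative F2 -> G}).
Hypothesis f_inj : injective f.
Implicit Types (l : bool * bool) (w v : seq (bool * bool)) (g h : G).

Let fM x y : f (x * y)%g = (f x * f y)%g. Proof. exact: gmulfM. Qed.

Let f1 : f 1%g = 1%g.
Proof. by apply: (mulgI (f 1%g)); rewrite -fM !mulg1. Qed.

Let fV x : f x^-1%g = (f x)^-1%g.
Proof. by apply: (mulgI (f x)); rewrite -fM !mulgV f1. Qed.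

Definition letter l : F2 := @FreeGroup bool [:: l] isT.

Section Cocycle.
Variable u : bool -> G -> bool.

(** The increment of the sought function along the edge from [g] labelled [l]:
    edges labelled by an inverse generator are traversed backwards, and over [Z/2]
    no sign is needed. *)
Definition letter_incr g l :=
  if l.2 then u l.1 (g * f (letter l))%g else u l.1 g.

Fixpoint word_incr g w :=
  if w is l :: w' then letter_incr g l (+) word_incr (g * f (letter l))%g w'
  else false.

Lemma letterV l : (letter l * letter (inv_letter l) = 1)%g.
Proof. by apply: val_inj; rewrite /= eqxx. Qed.

Lemma letter_incrV g l :
  letter_incr (g * f (letter l))%g (inv_letter l) = letter_incr g l.
Proof.
have := letterV l; case: l => i []; rewrite /letter_incr /= => lV.
  by [].
by rewrite -mulgA -fM lV f1 mulg1.
Qed.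

(** Going along an edge and back adds nothing, so the increment along a word does
    not change under free reduction. *)
Lemma word_incr_push g l w :
  word_incr g (push l w) = letter_incr g l (+) word_incr (g * f (letter l))%g w.
Proof.
case: w => //= l' w; case: eqP => //= ->.
by rewrite letter_incrV addbA addbb addFb -mulgA -fM letterV f1 mulg1.
Qed.

(** Hence the cocycle rule for products in the free group. *)
Lemma word_incr_mul g (x : F2) w :
  word_incr g (word_mul (free_word x) w) =
  word_incr g (free_word x) (+) word_incr (g * f x)%g w.
Proof.
case: x => v rv /=.
elim: v rv g => [|l v IH] rv g /=.
  by rewrite (_ : FreeGroup rv = 1%g) ?f1 ?mulg1 //; exact: val_inj.
have rv' := reduced_cons rv.
rewrite word_incr_push (IH rv') addbA -mulgA -fM.
congr (_ (+) word_incr (g * f _)%g w); apply: val_inj => /=.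
exact: push_reduced.
Qed.

(** On each left coset of the free group, start with the value false at a chosen
    representative and add up the increments along the unique reduced word that
    leads from it to a given element. *)
Lemma free_increments_onto :
  exists x : G -> bool,
    forall i g, x (g * f (letter (i, false)))%g = x g (+) u i g.
Proof.
pose orb g := [set h | exists x : F2, h = g * f x]%g.
have orbM g (w : F2) : orb (g * f w)%g = orb g.
  apply/seteqP; split=> h [v ->].
    by exists (w * v)%g; rewrite fM mulgA.
  by exists (w^-1 * v)%g; rewrite fM fV -!mulgA mulKVg.
pose r g := xget 1%g (orb g).
have coord g : exists x : F2, g = (r g * f x)%g.
  have [|x] := @xgetPex _ 1%g (orb g); first by exists g, 1%g; rewrite f1 mulg1.
  by rewrite -/(r g) => rg; exists x^-1%g; rewrite rg fV mulgK.
have [e eP] := choice coord.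
have eM g (w : F2) : e (g * f w)%g = (e g * w)%g.
  apply: f_inj; apply: (mulgI (r g)).
  have rM : r (g * f w)%g = r g by rewrite /r orbM.
  by rewrite -{1}rM -eP fM mulgA -eP.
exists (fun g => word_incr (r g) (free_word (e g))) => i g.
have rM : r (g * f (letter (i, false)))%g = r g by rewrite /r orbM.
by rewrite rM eM [free_word _]/= word_incr_mul -eP /= addbF.
Qed.

End Cocycle.
End FreeIncrements.

Section DifferenceCode.
Variables (G : groupType) (f : {multiplicative F2 -> G}).
Hypothesis f_inj : injective f.

Definition difference (i : bool) (x : G -> bool) : G -> bool :=
  fun g => x g (+) x (g * f (letter (i, false)))%g.

Definition bits (y : full_shift G 2) : G -> bool := fun g => y g == ord_max.

(** The bits [D_s (D_t^k y)], with [false] standing for [s] and [true] for [t]. *)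
Definition difference_code (y : full_shift G 2) g k : bool :=
  difference false (iter k (difference true) (bits y)) g.

Lemma difference_near i (P : full_shift G 2 -> G -> bool) :
  (forall y g, \forall y' \near y, P y' g = P y g) ->
  forall y g, \forall y' \near y, difference i (P y') g = difference i (P y) g.
Proof.
move=> near_P y g; near=> y'; rewrite /difference.
by congr (_ (+) _); near: y'; exact: near_P.
Unshelve. all: by end_near. Qed.

Lemma differences_onto (u v : G -> bool) :
  exists x, difference false x = u /\ difference true x = v.
Proof.
have [x xE] := free_increments_onto f_inj (fun i => if i then v else u).
by exists x; split; apply/funext => g; rewrite /difference xE addKb.
Qed.

(** Finitely many components are prescribed from the last to the first: given a
    configuration [x'] for the later ones, solve [D_s x = z 0] and [D_t x = x']. *)
Lemma difference_shift_code : shift_code difference_code.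
Proof.
have near_iter k y g : \forall y' \near y,
    iter k (difference true) (bits y') g = iter k (difference true) (bits y) g.
  elim: k y g => [|k IH] y g.
    by apply: filterS (near_coordinate y g) => y'; rewrite /= /bits => ->.
  exact: (@difference_near true (fun y => iter k (difference true) (bits y)) IH).
have code_near y g k : \forall y' \near y,
    difference_code y' g k = difference_code y g k.
  exact: (@difference_near false _ (near_iter k)).
split=> //.
- move=> h y g k; rewrite /difference_code.
  have iter_shift m g' : iter m (difference true) (bits (left_shift h y)) g' =
      iter m (difference true) (bits y) (h^-1 * g')%g.
    by elim: m g' => //= m IH g'; rewrite /difference !IH mulgA.
  by rewrite {1}/difference !iter_shift mulgA.
- move=> z; apply: onto_of_prefixes => // N.
  have [x xE] : exists x, forall g k, (k < N)%N ->
      difference false (iter k (difference true) x) g = z g k.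
    elim: N z => [|N IH] z; first by exists (fun=> false).
    have [x' x'E] := IH (fun g k => z g k.+1).
    have [x [xz xx']] := differences_onto (z^~ 0%N) x'.
    exists x => g [_|k kN]; first by rewrite /= xz.
    by rewrite iterSr xx' x'E.
  exists (fun g => if x g then ord_max else ord0) => g k kN.
  rewrite -(xE _ _ kN) /difference_code.
  congr (difference _ (iter _ _ _) _).
  by apply/funext => h; rewrite /bits; case: (x h).
Qed.

End DifferenceCode.

(** * Small extensions of all actions *)

Theorem theorem1p2 (R : realType) (G : groupType)
    (countableG : countable [set: G]) (nonamenableG : ~ amenable R G) :
  (exists n : nat, (0 < n)%N /\ universal_shift R G n) /\
  (contains_F2 G -> universal_shift R G 2).
Proof.
split; last first.
  by case=> f f_inj; exact: universal_shift_code (difference_shift_code f_inj).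
have [W dbl] := doubling_of_nonamenable nonamenableG.
have [a [b [abW a_inj b_inj ab]]] := paradoxical_of_doubling dbl.
exists #|walk_alphabet W|; split; last first.
  exact: universal_shift_code (walk_shift_code abW a_inj b_inj ab).
have [aW bW] := abW 1%g.
by apply/card_gt0P; exists ([` aW]%fset, [` bW]%fset, true).
Qed.
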